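(* Let $H$ be a Hilbert space, let $(S,T)\in B(H)^2$ be a twisted commuting pair, and let $H_0$ be the maximal closed subspace of $\ker ST$ that reduces both $S$ and $T$. Then $H_0$ reduces each twist of $(S,T)$, and it is the maximal subspace where the twist is not unique. More precisely, there is a unique unitary $U_1\in B(H\ominus H_0)$ commuting with $S|_{H\ominus H_0}$ and $T|_{H\ominus H_0}$ such that $ST|_{H\ominus H_0}=U_1\,TS|_{H\ominus H_0}$, and the set of all twists of $(S,T)$ is $$\{U_0\oplus U_1:\ U_0 \text{ is a unitary on } H_0,\ U_0\in\{S|_{H_0},T|_{H_0}\}'\}.$$
   Context: $B(H)$ denotes the bounded linear operators on $H$, and $\{\dots\}'$ denotes the commutant. A pair $(S,T)\in B(H)^2$ is called twisted commuting if there is a unitary $U\in\{S,T\}'$ with $ST=UTS$; any such $U$ is called a twist of $(S,T)$. A closed subspace reduces an operator if it is invariant under the operator and its adjoint. *)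

(* Defs.v *)
From HB Require Import structures.
From mathcomp Require Import all_boot all_order all_algebra.
From mathcomp Require Import sesquilinear complex.
From mathcomp Require Import boolp classical_sets reals topology normedtype.

Set Implicit Arguments.
Unset Strict Implicit.
Unset Printing Implicit Defensive.

Import Order.TTheory GRing.Theory Num.Theory Num.Def.
Import numFieldNormedType.Exports.

Local Open Scope classical_set_scope.
Local Open Scope ring_scope.

(* Complex Hilbert spaces of arbitrary dimension.  As in [sesquilinear], the
   inner product is linear in its first argument and conjugate-linear in its
   second one.  The norm of an [R[i]]-normed module takes its values in the
   nonnegative reals of [R[i]]. *)
HB.mixin Record CompleteNormedModule_isHilbert (R : realType) H
    & CompleteNormedModule R[i] H := {
  inner : {dot H for (@conjC R[i])} ;
  inner_norm : forall x : H, inner x x = `|x| ^+ 2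
}.

#[short(type="hilbertType")]
HB.structure Definition Hilbert (R : realType) :=
  {H of CompleteNormedModule R[i] H & CompleteNormedModule_isHilbert R H}.

Section InnerTheory.
Context (R : realType) (H : hilbertType R).
Implicit Types x y : H.

Lemma cauchy_schwarz x y : `|inner x y| <= `|x| * `|y|.
Proof.
have [->|y0] := eqVneq y 0; first by rewrite linear0r !normr0 mulr0.
have ny : 0 < `|y| ^+ 2 by rewrite exprn_gt0// normr_gt0.
have yR : (`|y| ^+ 2)^* = `|y| ^+ 2 by apply/CrealP; rewrite ger0_real// ltW.
pose a := inner x y / `|y| ^+ 2.
have : 0 <= inner (x - a *: y) (x - a *: y) by rewrite inner_norm exprn_ge0.
rewrite dnormB dnormZ !inner_norm linearZr_LR /=.
have aE : a * a^* * `|y| ^+ 2 = `|inner x y| ^+ 2 / `|y| ^+ 2.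
  rewrite /a rmorphM fmorphV /= yR normCK.
  by rewrite -!mulrA mulVf ?gt_eqF// mulr1 [X in _ * X]mulrC.
have aE' : a^* * inner x y = `|inner x y| ^+ 2 / `|y| ^+ 2.
  by rewrite /a rmorphM fmorphV /= yR normCK mulrC mulrA.
have tR : (`|inner x y| ^+ 2 / `|y| ^+ 2)^* = `|inner x y| ^+ 2 / `|y| ^+ 2.
  by apply/CrealP; rewrite ger0_real// divr_ge0// exprn_ge0.
rewrite normCK aE aE' tR opprD addrA addrK subr_ge0 ler_pdivrMr//.
by rewrite -exprMn ler_pXn2r// nnegrE ?mulr_ge0.
Qed.

End InnerTheory.

Section Subspace.
Context (R : realType) (H : hilbertType R).

Record closed_subspace := ClosedSubspace {
  subspace_set : set H ;
  subspace_submod : submod_closed (mem subspace_set) ;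
  subspace_closed : closed subspace_set }.

End Subspace.

Definition subspace_type (R : realType) (H : hilbertType R)
  (M : closed_subspace H) := {x : H | x \in subspace_set M}.

Section SubspaceHilbert.
Context (R : realType) (H : hilbertType R) (M : closed_subspace H).
Local Notation V := (subspace_type M).

HB.instance Definition _ :=
  [isSub of V for (@sval H (fun x => x \in subspace_set M))].
HB.instance Definition _ := [Choice of V by <:].
HB.instance Definition _ := GRing.SubChoice_isSubLmodule.Build R[i] H
  (mem (subspace_set M)) V
  (subspace_submod M).


Let norm (x : V) : R[i] := `|\val x|.

Let norm_triangle x y : norm (x + y) <= norm x + norm y.
Proof. by rewrite /norm raddfD ler_normD. Qed.

Let norm_scale (a : R[i]) x : norm (a *: x) = `|a| * norm x.
Proof. by rewrite /norm linearZ normrZ. Qed.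

Let norm_eq0 x : norm x = 0 -> x = 0.
Proof. by move=> /normr0_eq0 x0; apply: val_inj; rewrite raddf0. Qed.

HB.instance Definition _ :=
  Lmodule_isNormed.Build R[i] V norm_triangle norm_scale norm_eq0.

Let normB (x y : V) : `|x - y| = `|\val x - \val y|.
Proof. by rewrite -raddfB. Qed.

Let subspace_complete (F : set_system V) :
  ProperFilter F -> cauchy F -> cvg F.
Proof.
move=> FF /cauchyP Fc.
have Gc : cauchy ((\val : V -> H) @ F).
  apply/cauchyP => e e0; have [x xF] := Fc e e0; exists (\val x).
  rewrite /fmap /= /nbhs /=; apply: filterS xF => y.
  by rewrite -!ball_normE /= normB.
have /cvg_ex [l Gl] : cvg ((\val : V -> H) @ F).
  exact: cauchy_cvg Gc.
have Ml : subspace_set M l.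
  apply: (@closed_cvg _ H F FF (\val : V -> H) (subspace_set M)
    (@subspace_closed _ _ M) _ _ Gl).
  by apply: filterE => x; apply: set_mem; exact: (valP x).
apply/cvg_ex; exists (Sub l (mem_set Ml)).
apply/cvgrPdist_lt => e e0; have /cvgrPdist_lt/(_ e e0) := Gl.
by apply: filterS => x /=; rewrite normB SubK.
Qed.

HB.instance Definition _ := Uniform_isComplete.Build V subspace_complete.

Definition subspace_inner (x y : V) : R[i] := inner (\val x) (\val y).

Let inner_bilinear :
  bilinear_for *%R (@conjC R[i] \; *%R) subspace_inner.
Proof.
have valE a (x z : V) : \val (a *: x + z) = a *: \val x + \val z.
  exact: linearP.
split=> [y a x z|x a y z]; rewrite /subspace_inner valE.
  by rewrite linearDl linearZl_LR.
by rewrite linearDr linearZr_LR.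
Qed.

HB.instance Definition _ := bilinear_isBilinear.Build R[i] V V R[i] *%R
  (@conjC R[i] \; *%R) subspace_inner inner_bilinear.

Let inner_hermitian (x y : V) :
  subspace_inner x y = (-1) ^+ false * (subspace_inner y x)^*.
Proof. exact: hermC. Qed.

HB.instance Definition _ := isHermitianSesquilinear.Build R[i] V false
  (@conjC R[i]) subspace_inner inner_hermitian.

Let inner_gt0 (x : V) : x != 0 -> 0 < subspace_inner x x.
Proof. by rewrite -(inj_eq val_inj) raddf0 => ?; rewrite dnorm_gt0. Qed.

HB.instance Definition _ :=
  isDotProduct.Build R[i] V subspace_inner inner_gt0.

Let norm_inner (x : V) : subspace_inner x x = `|x| ^+ 2.
Proof. exact: inner_norm. Qed.

HB.instance Definition _ := CompleteNormedModule_isHilbert.Build R V norm_inner.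

End SubspaceHilbert.
Coercion subspace_type : closed_subspace >-> Sortclass.

Section Orthocomplement.
Context (R : realType) (H : hilbertType R) (M : closed_subspace H).

Let ortho : set H := [set x | forall y, subspace_set M y -> inner x y = 0].

Let ortho_submod : submod_closed (mem ortho).
Proof.
split=> [|a x y /set_mem xM /set_mem yM]; apply: mem_set => z Mz.
  exact: linear0l.
by rewrite linearDl linearZl_LR /= xM// yM// mulr0 addr0.
Qed.

Let ortho_closed : closed ortho.
Proof.
move=> x xM y My; have [->|y0] := eqVneq y 0; first exact: linear0r.
apply/eqP/negPn/negP => xy0.
have y_gt0 : 0 < `|y| by rewrite normr_gt0.
have e_gt0 : 0 < `|inner x y| / `|y| by rewrite divr_gt0// normr_gt0.
have [z [zM]] := xM _ (nbhsx_ballx x _ e_gt0).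
rewrite -ball_normE /= ltr_pdivlMr// => /(le_lt_trans (cauchy_schwarz _ _)).
have -> : inner (x - z) y = inner x y by rewrite linearBl /= (zM y My) subr0.
by rewrite ltxx.
Qed.

(* [orthocomplement M] is $H \ominus M$. *)
Definition orthocomplement : closed_subspace H :=
  ClosedSubspace ortho_submod ortho_closed.

End Orthocomplement.

Section Operators.
Context (R : realType) (H : hilbertType R).
Implicit Types (A S T U : H -> H) (M : closed_subspace H).

Definition bounded_operator A :=
  linear A /\ exists C : R, forall x, `|A x| <= (C%:C)%C * `|x|.

(* [adjoint A y] is the vector z with <A x, y> = <x, z> for all x; for a bounded
   operator A it exists by the Riesz representation theorem, and it is unique. *)
Definition adjoint A : H -> H :=
  fun y => xget 0 [set z | forall x, inner (A x) y = inner x z].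

Definition unitary U :=
  [/\ bounded_operator U, adjoint U \o U = idfun & U \o adjoint U = idfun].

Definition commutant (X : set (H -> H)) : set (H -> H) :=
  [set A | bounded_operator A /\ forall B, X B -> A \o B = B \o A].

Definition twist S T : set (H -> H) :=
  [set U | [/\ unitary U, commutant [set S; T] U & S \o T = U \o (T \o S)]].

Definition twisted_commuting S T :=
  [/\ bounded_operator S, bounded_operator T & exists U, twist S T U].

Definition reduces M A :=
  (forall x, subspace_set M x -> subspace_set M (A x)) /\
  (forall x, subspace_set M x -> subspace_set M (adjoint A x)).

Definition reducing_in_kernel S T M :=
  [/\ subspace_set M `<=` [set x | (S \o T) x = 0], reduces M S & reduces M T].

Definition maximal_reducing_in_kernel S T M :=
  reducing_in_kernel S T M /\
  forall N : closed_subspace H, reducing_in_kernel S T N ->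
    subspace_set N `<=` subspace_set M.

(* The default value of [insubd] is never taken when M is invariant under A. *)
Definition restriction M A : M -> M := fun x => insubd (0 : M) (A (\val x)).

(* The operator sending x0 + x1 to U0 x0 + U1 x1; since M is closed, every vector
   of H has exactly one decomposition of this form. *)
Definition direct_sum M (U0 : M -> M)
    (U1 : orthocomplement M -> orthocomplement M) : H -> H :=
  fun x => xget 0 [set z | exists (x0 : M) (x1 : orthocomplement M),
    x = \val x0 + \val x1 /\ z = \val (U0 x0) + \val (U1 x1)].

End Operators.

Arguments restriction {R H} M A.

(* Main.v *)
Require Import Defs.
From mathcomp Require Import all_boot all_order all_algebra.
From mathcomp Require Import sesquilinear complex.
From mathcomp Require Import ring lra.
From mathcomp Require Import boolp classical_sets reals topology normedtype.
Set Implicit Arguments.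
Unset Strict Implicit.
Unset Printing Implicit Defensive.
Import Order.TTheory GRing.Theory Num.Theory Num.Def.
Import numFieldNormedType.Exports.
Local Open Scope classical_set_scope.
Local Open Scope ring_scope.

(** Write a star-word for a product of factors among S, T, S* and T*.  The
    maximal reducing subspace of ker ST is
      H0 = { x | S T W x = 0 for every star-word W },
    because a reducing subspace of ker ST is stable under all star-words
    ([reducing_core_largest]).  This description by equations drives the rest.

    A unitary U commuting with S and T also commutes with S* and T*, hence with
    every star-word, so it maps the equations defining H0 to themselves; the
    same applies to U*.  So U reduces H0 ([commuting_unitary_reduces]), and it
    splits as U0 (+) U1 along H = H0 (+) K, where K is the orthocomplement of
    H0.

    For two twists U and V, put D = U - V.  Since UTS = ST = VTS, the product
    D T S vanishes, and for a star-word W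
      S T W D = U T S D W = U D T S W = 0.
    Hence D maps H into H0 ([twist_sub_in_core]); as D also maps K into itself,
    it vanishes on K.  This is the uniqueness of U1.

    Conversely, let U0 be any unitary on H0 commuting with the restrictions of
    S and T, and V any unitary on K solving the twist equations there.  Both ST
    and TS = U* ST vanish on H0, so the twist equation puts no constraint on U0
    and U0 (+) V is a twist ([twist_direct_sum]).  Applied to id (+) V, the
    previous paragraph shows that V is the restriction of U to K.

    The adjoints and the splitting H = H0 (+) K rest on the projection theorem
    ([orthogonal_decomposition]) and the Riesz representation theorem
    ([riesz_representation]). *)

(** * Inner products *)

Section InnerProduct.
Context (R : realType) (H : hilbertType R).
Implicit Types x y z : H.

Lemma innerDl x y z : inner (x + y) z = inner x z + inner y z.
Proof. exact: linearDl. Qed.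

Lemma innerDr x y z : inner x (y + z) = inner x y + inner x z.
Proof. exact: linearDr. Qed.

Lemma innerZl a x y : inner (a *: x) y = a * inner x y.
Proof. exact: linearZl_LR. Qed.

Lemma innerZr a x y : inner x (a *: y) = a^* * inner x y.
Proof. exact: linearZr_LR. Qed.

Lemma innerC x y : inner x y = (inner y x)^*.
Proof. by rewrite hermC expr0 mul1r. Qed.

Lemma inner0r x : inner x 0 = 0.
Proof. exact: linear0r. Qed.

Lemma innerBl x y z : inner (x - y) z = inner x z - inner y z.
Proof. exact: linearBl. Qed.

Lemma innerBr x y z : inner x (y - z) = inner x y - inner x z.
Proof. exact: linearBr. Qed.

Lemma parallelogram x y :
  `|x + y| ^+ 2 + `|x - y| ^+ 2 = `|x| ^+ 2 *+ 2 + `|y| ^+ 2 *+ 2.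
Proof.
rewrite -!inner_norm !(innerBl,innerBr,innerDl,innerDr); ring.
Qed.

Lemma inner_extr x y : (forall z, inner z x = inner z y) -> x = y.
Proof.
move=> xy; apply/eqP; rewrite -subr_eq0 -normr_eq0 -sqrf_eq0 -inner_norm.
by rewrite innerBr xy subrr.
Qed.

End InnerProduct.

(** * Orthogonal projection on a closed subspace *)

Section Projection.
Context (R : realType) (H : hilbertType R) (M : closed_subspace H).
Implicit Types x y z : H.

Lemma subspace0 : subspace_set M 0.
Proof. by have [h _] := subspace_submod M; apply: set_mem h. Qed.

Lemma subspaceZD a x y :
  subspace_set M x -> subspace_set M y -> subspace_set M (a *: x + y).
Proof.
have [_ h] := subspace_submod M => Mx My.
by apply: set_mem; apply: h; exact: mem_set.
Qed.

Lemma subspaceD x y :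
  subspace_set M x -> subspace_set M y -> subspace_set M (x + y).
Proof. by move=> Mx /(subspaceZD 1 Mx); rewrite scale1r. Qed.

Lemma subspaceZ a x : subspace_set M x -> subspace_set M (a *: x).
Proof. by move=> Mx; have := subspaceZD a Mx subspace0; rewrite addr0. Qed.

Lemma subspaceB x y :
  subspace_set M x -> subspace_set M y -> subspace_set M (x - y).
Proof. by move=> Mx My; rewrite addrC -scaleN1r; apply: subspaceZD. Qed.

(** Moving from [m] by a multiple [t * c] of [y], with [c] the inner product of
    [x - m] and [y], changes the squared distance to [x] by
    [- t |c|^2 (2 - t |y|^2)].  For small [t > 0] this is negative unless
    [c = 0]. *)
Lemma minimal_orthogonal x m : subspace_set M m ->
  (forall y, subspace_set M y -> `|x - m| <= `|x - y|) ->
  forall y, subspace_set M y -> inner (x - m) y = 0.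
Proof.
move=> Mm min y My; set e := x - m.
pose t : R[i] := (`|y| ^+ 2 + 1)^-1.
have y1 : 0 < `|y| ^+ 2 + 1 by rewrite ltr_wpDl// exprn_ge0.
have t0 : 0 < t by rewrite invr_gt0.
have tR : t^* = t by apply/CrealP; rewrite ger0_real// ltW.
have ty : t * `|y| ^+ 2 <= 1.
  by rewrite /t mulrC ler_pdivrMr// mul1r lerDl.
have : `|e| ^+ 2 <= `|e - (t * inner e y) *: y| ^+ 2.
  rewrite ler_pXn2r ?nnegrE// /e -addrA -opprD.
  by apply: min; apply: subspaceD => //; exact: subspaceZ.
clearbody e.
rewrite -!inner_norm !(innerBl,innerBr) !(innerZl, innerZr).
rewrite rmorphM /= tR [inner y e]innerC (inner_norm y).
set c := inner e y.
have -> : inner e e - t * c^* * c -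
    (t * c * c^* - t * c * (t * c^* * `|y| ^+ 2)) =
    inner e e - t * (c * c^*) * (2 - t * `|y| ^+ 2) by ring.
rewrite -normCK lerBrDr gerDl => le0.
apply/eqP; rewrite -normr_eq0 -sqrf_eq0 eq_le exprn_ge0// andbT.
have t2 : 0 < 2 - t * `|y| ^+ 2.
  by rewrite subr_gt0 (le_lt_trans ty)// ltr1n.
by move: le0; rewrite pmulr_lle0// pmulr_rle0.
Qed.

(* The norm takes its values in [R[i]], which is only partially ordered; the
   infimum of the distances is taken in [R]. *)
Let rnorm x : R := complex.Re `|x|.

Let rnormE x : `|x| = ((rnorm x)%:C)%C.
Proof. by rewrite /rnorm RRe_real// ger0_real. Qed.

Let rnorm_ge0 x : 0 <= rnorm x.
Proof. by rewrite -ler0c -rnormE. Qed.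

Let rnorm_triangle x y : rnorm (x + y) <= rnorm x + rnorm y.
Proof. by rewrite -lecR rmorphD /= -!rnormE ler_normD. Qed.

Let rparallelogram x y :
  rnorm (x + y) ^+ 2 + rnorm (x - y) ^+ 2 =
  rnorm x ^+ 2 *+ 2 + rnorm y ^+ 2 *+ 2.
Proof.
apply: (@complexI R).
by rewrite !(rmorphD, rmorphXn, rmorphMn) /= -!rnormE parallelogram.
Qed.

(** The points of [M] at distance less than [inf + e] from [x] form, as [e]
    tends to 0, a Cauchy filter: the midpoint of two of them is in [M], hence not
    closer to [x] than the infimum, and the parallelogram identity then forces
    the two points to be close to each other. *)
Lemma nearest_point x : exists2 m, subspace_set M m &
  forall y, subspace_set M y -> `|x - m| <= `|x - y|.
Proof.
pose E := [set rnorm (x - y) | y in subspace_set M].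
have Einf : has_inf E.
  split; first by exists (rnorm (x - 0)), 0 => //; exact: subspace0.
  by exists 0 => _ [y _ <-]; exact: rnorm_ge0.
pose d := inf E.
have dle y : subspace_set M y -> d <= rnorm (x - y).
  by move=> My; apply: ge_inf; [case: Einf | exists y].
have d0 : 0 <= d by apply: lb_le_inf; [case: Einf | move=> _ [y _ <-]].
pose B (e : R) := [set y | subspace_set M y /\ rnorm (x - y) < d + e].
pose F := filter_from [set e : R | 0 < e] B.
have FF : ProperFilter F.
  apply: filter_from_proper => [|e /= e0].
    apply: filter_from_filter; first by exists 1 => /=.
    move=> i j /= i0 j0; exists (Num.min i j) => /=; first by rewrite lt_min i0.
    move=> y [My ylt]; split; split=> //; apply: (lt_le_trans ylt);
      by rewrite lerD2l ge_min lexx ?orbT.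
  by have [_ [y My <-] ylt] := inf_adherent e0 Einf; exists y.
have Fcauchy e : 0 < e -> exists2 s, 0 < s &
    forall y z, B s y -> B s z -> rnorm (y - z) < e.
  (* With both distances below [d + s], the parallelogram identity bounds the
     squared norm of [y - z] by [4 (d + s)^2 - 4 d^2], that is by
     [8 d s + 4 s^2], which is less than [s (8 d + 5)] when [s <= 1]. *)
  move=> e0; pose s := Num.min 1 (e ^+ 2 / (8 * d + 5)).
  have D0 : 0 < 8 * d + 5 by rewrite ltr_wpDl// mulr_ge0.
  have s0 : 0 < s by rewrite lt_min ltr01 divr_gt0 ?exprn_gt0.
  have s1 : s <= 1 by rewrite ge_min lexx.
  have sD : s * (8 * d + 5) <= e ^+ 2.
    by rewrite -ler_pdivlMr// ge_min lexx orbT.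
  exists s => // y z [My ylt] [Mz zlt].
  have := rparallelogram (x - y) (x - z).
  have -> : x - y - (x - z) = z - y by rewrite opprB addrC addrA subrK.
  have -> : x - y + (x - z) = 2 *: (x - 2^-1 *: (y + z)).
    rewrite scalerBr scalerA mulfV ?pnatr_eq0// scale1r.
    by rewrite scaler_nat mulr2n opprD addrACA.
  have -> : rnorm (2 *: (x - 2^-1 *: (y + z))) =
            2 * rnorm (x - 2^-1 *: (y + z)).
    apply: (@complexI R); rewrite rmorphM /= -!rnormE normrZ.
    by rewrite rmorph_nat ger0_norm.
  have -> : rnorm (z - y) = rnorm (y - z) by rewrite /rnorm distrC.
  have := dle _ (subspaceZ 2^-1 (subspaceD My Mz)).
  move: (rnorm (x - _ *: _)) (rnorm_ge0 (x - y)) (rnorm_ge0 (x - z)) ylt zlt.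
  move=> w.
  move: (rnorm (x - y)) (rnorm (x - z)) (rnorm_ge0 (y - z)) => p q.
  move: (rnorm (y - z)) => r r0 p0 q0 pd qd dw pq.
  rewrite -(@ltr_pXn2r _ 2)// ?nnegrE// ?(ltW e0)//.
  have p2 : p ^+ 2 <= (d + s) ^+ 2.
    by rewrite ler_pXn2r ?nnegrE ?addr_ge0 ?(ltW s0)// ltW.
  have q2 : q ^+ 2 <= (d + s) ^+ 2.
    by rewrite ler_pXn2r ?nnegrE ?addr_ge0 ?(ltW s0)// ltW.
  have w2 : d ^+ 2 <= w ^+ 2 by rewrite ler_pXn2r ?nnegrE// (le_trans d0).
  nra.
have : cauchy F.
  apply/cauchyP => e e0.
  have eE : e = ((complex.Re e)%:C)%C by rewrite RRe_real// gtr0_real.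
  have [|s s0 sB] := Fcauchy (complex.Re e).
    by rewrite -ltcR -eE.
  have Fs : F (B s) by exists s.
  have [y By] := filter_ex Fs.
  exists y, s => // z Bz; rewrite -ball_normE /= eE rnormE ltcR; exact: sB.
move=> /cauchy_cvg /cvg_ex [m Fm].
exists m.
  apply: (@closed_cvg _ H F FF id (subspace_set M)
    (@subspace_closed _ _ M) _ _ Fm).
  by exists 1 => //= y [].
move=> y /dle dy; rewrite !rnormE lecR; apply: le_trans dy.
apply/ler_addgt0Pr => e e0.
have e2 : 0 < e / 2 by rewrite divr_gt0.
have Fs : F (B (e / 2)) by exists (e / 2).
have e2C : 0 < ((e / 2)%:C)%C :> R[i] by rewrite ltcR.
have [z [[_ zd]]] := filter_ex (filterI Fs (Fm _ (nbhsx_ballx m _ e2C))).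
rewrite -ball_normE /= rnormE ltcR => mz.
have -> : x - m = (x - z) + (z - m) by rewrite addrA subrK.
apply: (le_trans (rnorm_triangle _ _)).
have -> : rnorm (z - m) = rnorm (m - z) by rewrite /rnorm distrC.
lra.
Qed.

Lemma orthogonal_decomposition x :
  exists (x0 : M) (x1 : orthocomplement M), x = \val x0 + \val x1.
Proof.
have [m Mm min] := nearest_point x.
have om : subspace_set (orthocomplement M) (x - m).
  exact: minimal_orthogonal.
exists (Sub m (mem_set Mm)), (Sub (x - m) (mem_set om)).
by rewrite !SubK addrC subrK.
Qed.

End Projection.

(** * The Riesz representation theorem and adjoints *)

Section BoundedOperators.
Context (R : realType) (H : hilbertType R).
Implicit Types (x y z : H) (A B U : H -> H).

(** Stated for a map into any normed group, so as to serve both for operators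
    and for linear functionals. *)
Lemma lipschitz_kernel_closed (W : normedZmodType R[i]) (f : H -> W) (C : R) :
  (forall x y, `|f x - f y| <= (C%:C)%C * `|x - y|) ->
  closed [set x | f x = 0].
Proof.
move=> fC x fx; apply/eqP/negPn/negP => fx0.
have C0 : 0 < (`|C|%:C)%C + 1 :> R[i] by rewrite ltr_wpDl// lecR.
have e0 : 0 < `|f x| / ((`|C|%:C)%C + 1) by rewrite divr_gt0// normr_gt0.
have [z [fz]] := fx _ (nbhsx_ballx x _ e0).
rewrite -ball_normE /= ltr_pdivlMr// => xz.
suff : `|f x| < `|f x| by rewrite ltxx.
apply: le_lt_trans xz; have := fC x z; rewrite fz subr0 => /le_trans; apply.
rewrite mulrC ler_wpM2l// (@le_trans _ _ (`|C|%:C)%C) ?lerDl//.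
by rewrite lecR ler_norm.
Qed.

(** A nonzero functional is determined by its kernel up to a scalar, and the
    kernel is closed, so it has a nonzero orthogonal vector [e]; the representing
    vector is the multiple of [e] for which both sides agree on [e]. *)
Lemma riesz_representation (f : H -> R[i]) (C : R) :
  (forall a x y, f (a *: x + y) = a * f x + f y) ->
  (forall x, `|f x| <= (C%:C)%C * `|x|) ->
  exists z, forall x, f x = inner x z.
Proof.
move=> flin fC.
have f0 : f 0 = 0.
  by apply/eqP; rewrite -normr_le0 (le_trans (fC 0))// normr0 mulr0.
have fB x y : f (x - y) = f x - f y.
  by rewrite addrC -scaleN1r flin mulN1r addrC.
have ker_submod : submod_closed (mem [set x | f x = 0]).
  split=> [|a x y /set_mem /= fx /set_mem /= fy]; apply: mem_set => //=.
  by rewrite flin fx fy mulr0 addr0.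
have ker_closed : closed [set x | f x = 0].
  by apply: (@lipschitz_kernel_closed _ f C) => x y; rewrite -fB.
pose N := ClosedSubspace ker_submod ker_closed.
have [fall|] := pselect (forall x, f x = 0).
  by exists 0 => x; rewrite inner0r fall.
move=> /existsNP[u fu].
have [m [e ume]] := orthogonal_decomposition N u.
have fe : f (\val e) != 0.
  apply/eqP => fe; apply: fu; rewrite ume -[\val m]scale1r flin fe.
  by rewrite (set_mem (valP m)) mulr0 addr0.
have ee0 : inner (\val e) (\val e) != 0.
  rewrite inner_norm sqrf_eq0 normr_eq0; apply: contraNneq fe => ->.
  by rewrite f0.
exists ((f (\val e) / inner (\val e) (\val e))^* *: \val e) => x.
rewrite innerZr conjCK.
have kx : f (x - (f x / f (\val e)) *: \val e) = 0.
  rewrite fB -[X in f x - f X]addr0 flin f0 addr0.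
  by rewrite divfK// subrr.
have := set_mem (valP e) _ kx; rewrite innerC innerBl innerZl.
move=> /(congr1 conjC); rewrite conjCK rmorph0 => /eqP.
rewrite subr_eq0 => /eqP ->.
by field; rewrite fe ee0.
Qed.

Lemma bounded_operatorD A x y : bounded_operator A -> A (x + y) = A x + A y.
Proof. by case=> lA _; have := lA 1 x y; rewrite !scale1r. Qed.

Lemma bounded_operator0 A : bounded_operator A -> A 0 = 0.
Proof.
by move=> bA; apply: (addrI (A 0)); rewrite -bounded_operatorD// !addr0.
Qed.

Lemma bounded_operatorZ A a x : bounded_operator A -> A (a *: x) = a *: A x.
Proof.
by move=> bA; case: (bA) => /(_ a x 0); rewrite (bounded_operator0 bA) !addr0.
Qed.

Lemma bounded_operatorB A x y : bounded_operator A -> A (x - y) = A x - A y.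
Proof.
move=> bA; rewrite bounded_operatorD// -scaleN1r.
by rewrite bounded_operatorZ// scaleN1r.
Qed.

Lemma nonneg_bound A : bounded_operator A ->
  exists2 C : R, 0 <= C & forall x, `|A x| <= (C%:C)%C * `|x|.
Proof.
case=> _ [C Ale]; exists `|C| => // x; apply: le_trans (Ale x) _.
by rewrite ler_wpM2r// lecR ler_norm.
Qed.

Lemma bounded_operator_id : bounded_operator (idfun : H -> H).
Proof. by split=> //; exists 1 => x; rewrite mul1r. Qed.

Lemma bounded_operator_comp A B :
  bounded_operator A -> bounded_operator B -> bounded_operator (A \o B).
Proof.
move=> bA bB; split.
  by move=> a x y /=; case: bB => -> _; case: bA => ->.
have [C C0 Ale] := nonneg_bound bA; have [D _ Ble] := nonneg_bound bB.
exists (C * D) => x /=; apply: le_trans (Ale _) _.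
by rewrite rmorphM -mulrA ler_wpM2l// lecR.
Qed.

Lemma kernel_closed A : bounded_operator A -> closed [set x | A x = 0].
Proof.
move=> bA; have [_ [C Ale]] := bA.
by apply: (@lipschitz_kernel_closed _ A C) => x y; rewrite -bounded_operatorB.
Qed.

Lemma adjoint_eq A y z :
  (forall x, inner (A x) y = inner x z) -> adjoint A y = z.
Proof.
move=> Az; rewrite /adjoint; case: xgetP => [w _ Aw|/(_ z)//].
by apply: inner_extr => x; rewrite -Aw Az.
Qed.

Lemma adjointP A x y :
  bounded_operator A -> inner (A x) y = inner x (adjoint A y).
Proof.
move=> bA; have [lA [C Ale]] := bA.
have [a u v|u|z zP] := @riesz_representation (fun x => inner (A x) y)
    (C * complex.Re `|y|).
- by rewrite lA innerDl innerZl.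
- apply: le_trans (cauchy_schwarz _ _) _.
  rewrite rmorphM /= RRe_real ?ger0_real// mulrAC.
  by rewrite ler_wpM2r.
by rewrite zP (adjoint_eq zP).
Qed.

Lemma adjointPl A x y :
  bounded_operator A -> inner (adjoint A x) y = inner x (A y).
Proof. by move=> bA; rewrite innerC -adjointP// -innerC. Qed.

Lemma adjointK A : bounded_operator A -> adjoint (adjoint A) = A.
Proof.
by move=> bA; apply/funext => y; apply: adjoint_eq => x; rewrite adjointPl.
Qed.

Lemma adjoint_comp A B : bounded_operator A -> bounded_operator B ->
  adjoint (A \o B) = adjoint B \o adjoint A.
Proof.
move=> bA bB; apply/funext => y; apply: adjoint_eq => x /=.
by rewrite !adjointP.
Qed.

(** The same bound [C] works: the squared norm of [adjoint A x] is the inner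
    product of [x] with [A (adjoint A x)], at most
    [C * `|x| * `|adjoint A x|]. *)
Lemma bounded_operator_adjoint A :
  bounded_operator A -> bounded_operator (adjoint A).
Proof.
move=> bA; split.
  move=> a x y; apply: adjoint_eq => z.
  by rewrite !innerDr !innerZr !adjointP.
have [C C0 Ale] := nonneg_bound bA; exists C => x.
have [->|ax0] := eqVneq (adjoint A x) 0.
  by rewrite normr0 mulr_ge0// lecR.
rewrite -(@ler_pM2r _ `|adjoint A x|) ?normr_gt0// -expr2 -inner_norm.
rewrite adjointPl//.
apply: le_trans (_ : `|inner x (A (adjoint A x))| <= _).
  by rewrite ger0_norm// -adjointPl// inner_norm exprn_ge0.
apply: le_trans (cauchy_schwarz _ _) _.
by rewrite mulrAC mulrC ler_wpM2r.
Qed.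

Lemma unitary_adjoint U : unitary U -> unitary (adjoint U).
Proof.
by case=> bU UU UU'; split; rewrite ?adjointK//; exact: bounded_operator_adjoint.
Qed.

Lemma unitary_idfun : unitary (idfun : H -> H).
Proof.
have a1 : adjoint (idfun : H -> H) = idfun.
  by apply/funext => y; exact: adjoint_eq.
by split; rewrite ?a1//; exact: bounded_operator_id.
Qed.

Lemma commute_adjoint A B : bounded_operator A -> bounded_operator B ->
  A \o B = B \o A -> adjoint A \o adjoint B = adjoint B \o adjoint A.
Proof. by move=> bA bB AB; rewrite -!adjoint_comp// AB. Qed.

Lemma unitary_commute_adjointl U A : unitary U ->
  U \o A = A \o U -> adjoint U \o A = A \o adjoint U.
Proof.
case=> _ UU UU' UA; apply/funext => x /=.
have {1}<- : U (adjoint U x) = x by move: (congr1 (@^~ x) UU').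
have -> : A (U (adjoint U x)) = U (A (adjoint U x)).
  by rewrite -[RHS]/((U \o A) _) UA.
by move: (congr1 (@^~ (A (adjoint U x))) UU).
Qed.

(** Commuting with [A] passes to the inverse of [U], and taking adjoints of
    [U* A = A U*] gives the claim. *)
Lemma unitary_commute_adjointr U A : unitary U -> bounded_operator A ->
  U \o A = A \o U -> U \o adjoint A = adjoint A \o U.
Proof.
move=> uU bA /(unitary_commute_adjointl uU); case: (uU) => bU _ _.
have bU' := bounded_operator_adjoint bU.
by move=> /(commute_adjoint bU' bA); rewrite adjointK.
Qed.

End BoundedOperators.

(** * Reducing subspaces, restrictions and direct sums *)

Section Reduction.
Context (R : realType) (H : hilbertType R).
Implicit Types (M : closed_subspace H) (A B U : H -> H).

Lemma val_linear M a (x y : M) : \val (a *: x + y) = a *: \val x + \val y.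
Proof. exact: linearP. Qed.

Lemma reduces_id M : reduces M idfun.
Proof.
split=> // x Mx; have -> : adjoint idfun x = x by exact: adjoint_eq.
exact: Mx.
Qed.

Lemma reduces_comp M A B : bounded_operator A -> bounded_operator B ->
  reduces M A -> reduces M B -> reduces M (A \o B).
Proof.
move=> bA bB [MA MA'] [MB MB']; split=> x Mx; first exact/MA/MB.
by rewrite adjoint_comp//; apply/MB'/MA'.
Qed.

Lemma reduces_adjoint M A :
  bounded_operator A -> reduces M A -> reduces M (adjoint A).
Proof. by move=> bA [MA MA']; split; rewrite ?adjointK. Qed.

Lemma reduces_orthocomplement M A :
  bounded_operator A -> reduces M A -> reduces (orthocomplement M) A.
Proof.
move=> bA [MA MA']; split=> x Mx /= y My.
  by rewrite adjointP//; exact: Mx (MA' _ My).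
by rewrite adjointPl//; exact: Mx (MA _ My).
Qed.

Section Restriction.
Context (M : closed_subspace H).

Lemma val_restriction A (x : M) :
  reduces M A -> \val (restriction M A x) = A (\val x).
Proof.
case=> MA _; rewrite /restriction val_insubd ifT//.
by apply/mem_set/MA/set_mem/valP.
Qed.

Lemma restriction_comp A B : reduces M B ->
  restriction M (A \o B) = restriction M A \o restriction M B.
Proof.
move=> MB; apply/funext => x.
by rewrite -[LHS]/(insubd (0 : M) (A (B (\val x)))) -(val_restriction x MB).
Qed.

Lemma restriction_id : restriction M idfun = idfun.
Proof.
apply/funext => x; apply: val_inj; rewrite val_restriction//.
exact: reduces_id.
Qed.

Lemma bounded_operator_restriction A :
  bounded_operator A -> reduces M A -> bounded_operator (restriction M A).
Proof.
move=> [lA [C Ale]] MA; split.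
  move=> a x y; apply: val_inj; rewrite val_restriction// val_linear lA.
  by rewrite val_linear !val_restriction.
exists C => x.
by rewrite -[`|_|]/(`|\val (restriction M A x)|) val_restriction.
Qed.

Lemma adjoint_restriction A : bounded_operator A -> reduces M A ->
  adjoint (restriction M A) = restriction M (adjoint A).
Proof.
move=> bA MA; apply/funext => y; apply: adjoint_eq => x.
have MA' := reduces_adjoint bA MA.
rewrite -[LHS]/(inner (\val (restriction M A x)) (\val y)).
rewrite -[RHS]/(inner (\val x) (\val (restriction M (adjoint A) y))).
by rewrite !val_restriction// adjointP.
Qed.

Lemma unitary_restriction U :
  unitary U -> reduces M U -> unitary (restriction M U).
Proof.
move=> [bU UU UU'] MU; have MU' := reduces_adjoint bU MU.
split; first exact: bounded_operator_restriction.
  by rewrite adjoint_restriction// -restriction_comp// UU restriction_id.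
by rewrite adjoint_restriction// -restriction_comp// UU' restriction_id.
Qed.

Lemma restriction_commute A B : reduces M A -> reduces M B ->
  A \o B = B \o A ->
  restriction M A \o restriction M B = restriction M B \o restriction M A.
Proof. by move=> MA MB AB; rewrite -!restriction_comp// AB. Qed.

End Restriction.

Section DirectSum.
Context (M : closed_subspace H).
Local Notation K := (orthocomplement M).

Lemma inner_orthocomplement (x0 : M) (x1 : K) : inner (\val x0) (\val x1) = 0.
Proof.
by rewrite innerC (set_mem (valP x1) _ (set_mem (valP x0))) rmorph0.
Qed.

Lemma inner_decomposition (x0 y0 : M) (x1 y1 : K) :
  inner (\val x0 + \val x1) (\val y0 + \val y1) = inner x0 y0 + inner x1 y1.
Proof.
rewrite innerDl !innerDr inner_orthocomplement.
rewrite [inner (\val x1) (\val y0)]innerC.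
by rewrite inner_orthocomplement rmorph0 addr0 add0r.
Qed.

Lemma pythagoras (x0 : M) (x1 : K) :
  `|\val x0 + \val x1| ^+ 2 = `|x0| ^+ 2 + `|x1| ^+ 2.
Proof. by rewrite -!inner_norm inner_decomposition. Qed.

Lemma decomposition_inj (x0 y0 : M) (x1 y1 : K) :
  \val x0 + \val x1 = \val y0 + \val y1 -> x0 = y0 /\ x1 = y1.
Proof.
move=> xy; have : \val (x0 - y0) + \val (x1 - y1) = 0.
  by rewrite !raddfB /= addrACA -opprD xy subrr.
move=> /(congr1 (fun z => `|z| ^+ 2)).
rewrite pythagoras normr0 expr0n /= => /eqP.
rewrite paddr_eq0 ?exprn_ge0// !sqrf_eq0 !normr_eq0 !subr_eq0.
by move=> /andP[/eqP -> /eqP ->].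
Qed.

Lemma direct_sumE (A0 : M -> M) (A1 : K -> K) (x0 : M) (x1 : K) :
  direct_sum A0 A1 (\val x0 + \val x1) = \val (A0 x0) + \val (A1 x1).
Proof.
rewrite /direct_sum; case: xgetP => [z _ /= [y0 [y1 [xy ->]]]|].
  by have [-> ->] := decomposition_inj xy.
by move=> /(_ (\val (A0 x0) + \val (A1 x1))) []; exists x0, x1.
Qed.

Lemma direct_sum_comp (A0 B0 : M -> M) (A1 B1 : K -> K) :
  direct_sum A0 A1 \o direct_sum B0 B1 = direct_sum (A0 \o B0) (A1 \o B1).
Proof.
apply/funext => x; have [x0 [x1 ->]] := orthogonal_decomposition M x.
by rewrite /= !direct_sumE.
Qed.

Lemma direct_sum_id : direct_sum (idfun : M -> M) (idfun : K -> K) = idfun.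
Proof.
apply/funext => x; have [x0 [x1 ->]] := orthogonal_decomposition M x.
by rewrite direct_sumE.
Qed.

(** With [direct_sum_comp] this turns identities between operators reduced by [M]
    into identities between their two blocks. *)
Lemma direct_sum_restriction A : bounded_operator A -> reduces M A ->
  direct_sum (restriction M A) (restriction K A) = A.
Proof.
move=> bA MA; have KA := reduces_orthocomplement bA MA.
apply/funext => x; have [x0 [x1 ->]] := orthogonal_decomposition M x.
by rewrite direct_sumE !val_restriction// bounded_operatorD.
Qed.

Lemma adjoint_direct_sum (A0 : M -> M) (A1 : K -> K) :
  bounded_operator A0 -> bounded_operator A1 ->
  adjoint (direct_sum A0 A1) = direct_sum (adjoint A0) (adjoint A1).
Proof.
move=> bA0 bA1; apply/funext => y; apply: adjoint_eq => x.
have [x0 [x1 ->]] := orthogonal_decomposition M x.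
have [y0 [y1 ->]] := orthogonal_decomposition M y.
by rewrite !direct_sumE !inner_decomposition !adjointP.
Qed.

Lemma bounded_operator_direct_sum (A0 : M -> M) (A1 : K -> K) :
  bounded_operator A0 -> bounded_operator A1 ->
  bounded_operator (direct_sum A0 A1).
Proof.
move=> bA0 bA1; split.
  move=> a x y; have [x0 [x1 ->]] := orthogonal_decomposition M x.
  have [y0 [y1 ->]] := orthogonal_decomposition M y.
  have -> : a *: (\val x0 + \val x1) + (\val y0 + \val y1) =
            \val (a *: x0 + y0) + \val (a *: x1 + y1).
    by rewrite !val_linear scalerDr addrACA.
  rewrite !direct_sumE; case: bA0 => -> _; case: bA1 => -> _.
  by rewrite !val_linear scalerDr addrACA.
have [C0 C00 A0le] := nonneg_bound bA0; have [C1 C10 A1le] := nonneg_bound bA1.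
exists (C0 + C1) => x; have [x0 [x1 ->]] := orthogonal_decomposition M x.
rewrite direct_sumE; apply: le_trans (ler_normD _ _) _.
rewrite rmorphD mulrDl; apply: lerD.
  apply: le_trans (A0le _) _; rewrite ler_wpM2l ?lecR//.
  by rewrite -(@ler_pXn2r _ 2)// ?nnegrE// pythagoras lerDl exprn_ge0.
apply: le_trans (A1le _) _; rewrite ler_wpM2l ?lecR//.
by rewrite -(@ler_pXn2r _ 2)// ?nnegrE// pythagoras lerDr exprn_ge0.
Qed.

Lemma unitary_direct_sum (A0 : M -> M) (A1 : K -> K) :
  unitary A0 -> unitary A1 -> unitary (direct_sum A0 A1).
Proof.
move=> [bA0 U0 U0'] [bA1 U1 U1']; split.
- exact: bounded_operator_direct_sum.
- by rewrite adjoint_direct_sum// direct_sum_comp U0 U1 direct_sum_id.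
- by rewrite adjoint_direct_sum// direct_sum_comp U0' U1' direct_sum_id.
Qed.

End DirectSum.
End Reduction.

(** * The maximal reducing subspace of the kernel, and twists *)

Section Twists.
Context (R : realType) (H : hilbertType R) (S T : H -> H).
Hypotheses (bS : bounded_operator S) (bT : bounded_operator T).

(** Words grow on the right so that [W \o A] applied to [x] is [W] applied to
    [A x]: the space cut out by all words is then stable under the
    generators. *)
Inductive star_word : set (H -> H) :=
  | star_word_id : star_word idfun
  | star_word_comp W A : star_word W ->
      [set S; T; adjoint S; adjoint T] A -> star_word (W \o A).

Lemma bounded_generator A :
  [set S; T; adjoint S; adjoint T] A -> bounded_operator A.
Proof.
by case=> [[[|]|]|] ->//; exact: bounded_operator_adjoint.
Qed.

Lemma bounded_star_word W : star_word W -> bounded_operator W.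
Proof.
elim=> [|V A _ bV /bounded_generator]; first exact: bounded_operator_id.
exact: bounded_operator_comp.
Qed.

Lemma star_word_generators : star_word S /\ star_word T.
Proof.
split.
  by apply: (star_word_comp star_word_id); do 3!left.
by apply: (star_word_comp star_word_id); do 2!left; right.
Qed.

Let core : set H := [set x | forall W, star_word W -> S (T (W x)) = 0].

Let core_submod : submod_closed (mem core).
Proof.
have bW W : star_word W -> bounded_operator (S \o (T \o W)).
  move=> /bounded_star_word/(bounded_operator_comp bT).
  exact: bounded_operator_comp.
split=> [|a x y /set_mem xC /set_mem yC]; apply: mem_set => W sW.
  exact: (bounded_operator0 (bW W sW)).
have [/(_ a x y) /= -> _] := bW W sW.
by rewrite (xC W sW) (yC W sW) scaler0 addr0.
Qed.

Let core_closed : closed core.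
Proof.
move=> x xC W sW.
have bTW := bounded_operator_comp bT (bounded_star_word sW).
have b := bounded_operator_comp bS bTW.
apply: (kernel_closed b); apply: closure_subset xC => y yC; exact: yC.
Qed.

Definition reducing_core : closed_subspace H :=
  ClosedSubspace core_submod core_closed.

(** Each generator is stable on the core since it only lengthens the words; the
    generators come with their adjoints, so the core reduces. *)
Lemma reducing_core_in_kernel : reducing_in_kernel S T reducing_core.
Proof.
have inv A : [set S; T; adjoint S; adjoint T] A ->
    forall x, subspace_set reducing_core x -> subspace_set reducing_core (A x).
  by move=> gA x xC W sW; apply: (xC (W \o A)); exact: star_word_comp.
split.
- by move=> x /(_ idfun star_word_id).
- by split; apply: inv; [do 3!left|left; right].
- by split; apply: inv; [do 2!left; right|right].
Qed.

Lemma reducing_core_largest (N : closed_subspace H) :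
  reducing_in_kernel S T N ->
  subspace_set N `<=` subspace_set reducing_core.
Proof.
move=> [Nker [NS NS'] [NT NT']] x Nx W sW; apply: Nker.
elim: sW x Nx => [//|V A _ IH gA] x Nx; apply: IH.
by case: gA => [[[|]|]|] ->; auto.
Qed.

Lemma maximal_reducing_core : maximal_reducing_in_kernel S T reducing_core.
Proof.
by split; [exact: reducing_core_in_kernel | exact: reducing_core_largest].
Qed.

Lemma maximal_reducingE (M : closed_subspace H) :
  maximal_reducing_in_kernel S T M ->
  subspace_set M = subspace_set reducing_core.
Proof.
move=> [rM maxM]; apply/seteqP; split; first exact: reducing_core_largest.
exact/maxM/reducing_core_in_kernel.
Qed.

Lemma commute_star_word U W x :
  unitary U -> commutant [set S; T] U -> star_word W -> U (W x) = W (U x).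
Proof.
move=> uU [_ comm] sW.
suff UW : U \o W = W \o U by move: (congr1 (@^~ x) UW).
elim: sW => [//|V A _ IH gA].
have UA : U \o A = A \o U.
  case: gA => [[[|]|]|] ->.
  - by apply: comm; left.
  - by apply: comm; right.
  - by apply: unitary_commute_adjointr => //; apply: comm; left.
  - by apply: unitary_commute_adjointr => //; apply: comm; right.
by rewrite compA IH -compA UA.
Qed.

Lemma commutant_adjoint U :
  unitary U -> commutant [set S; T] U -> commutant [set S; T] (adjoint U).
Proof.
move=> uU [bU comm]; split; first exact: bounded_operator_adjoint.
by move=> B /comm; exact: unitary_commute_adjointl.
Qed.

(** [S T W (U x) = U (S T W x)], so [U] preserves the equations of the core, and
    so does its adjoint. *)
Lemma commuting_unitary_reduces U (M : closed_subspace H) :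
  maximal_reducing_in_kernel S T M ->
  unitary U -> commutant [set S; T] U -> reduces M U.
Proof.
move=> maxM uU cU.
suff inv V : unitary V -> commutant [set S; T] V ->
    forall x, subspace_set reducing_core x -> subspace_set reducing_core (V x).
  rewrite /reduces (maximal_reducingE maxM); split; first exact: inv.
  by apply: inv; [exact: unitary_adjoint|exact: commutant_adjoint].
have [sS sT] := star_word_generators.
move=> uV cV x xC W sW; rewrite -(commute_star_word x uV cV sW).
rewrite -(commute_star_word _ uV cV sT) -(commute_star_word _ uV cV sS).
by rewrite (xC W sW) (bounded_operator0 (proj1 cV)).
Qed.

(** Uniqueness of the twist away from the core: with [D = U - V], the product
    [S T W D] equals [U T S W D], hence [U D T S W] since [D] commutes with
    words, and [D T S = 0] because [U T S = V T S]. *)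
Lemma twist_sub_in_core U V x : twist S T U -> twist S T V ->
  subspace_set reducing_core (U x - V x).
Proof.
move=> [uU cU STU] [uV cV STV] W sW; have [sS sT] := star_word_generators.
have STE y : S (T y) = U (T (S y)) by move: (congr1 (@^~ y) STU).
have STE' y : S (T y) = V (T (S y)) by move: (congr1 (@^~ y) STV).
have [bU bW] := (proj1 cU, bounded_star_word sW).
rewrite STE !bounded_operatorB//.
rewrite -(commute_star_word x uU cU sW) -(commute_star_word x uV cV sW).
rewrite -(commute_star_word _ uU cU sS) -(commute_star_word _ uV cV sS).
rewrite -(commute_star_word _ uU cU sT) -(commute_star_word _ uV cV sT).
by rewrite -STE -STE' subrr.
Qed.

Section Decomposition.
Context (M : closed_subspace H).
Hypothesis maxM : maximal_reducing_in_kernel S T M.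
Local Notation K := (orthocomplement M).

(** The conditions that single out the summand on [K] shared by all twists. *)
Definition residual_twist (V : K -> K) :=
  [/\ unitary V, commutant [set restriction K S; restriction K T] V
    & restriction K (S \o T) = V \o restriction K (T \o S)].

Let MS : reduces M S. Proof. by case: maxM => -[]. Qed.
Let MT : reduces M T. Proof. by case: maxM => -[]. Qed.
Let KS : reduces K S. Proof. exact: reduces_orthocomplement. Qed.
Let KT : reduces K T. Proof. exact: reduces_orthocomplement. Qed.

Lemma commutant_restriction (N : closed_subspace H) U :
  reduces N S -> reduces N T -> reduces N U -> commutant [set S; T] U ->
  commutant [set restriction N S; restriction N T] (restriction N U).
Proof.
move=> NS NT NU [bU comm]; split; first exact: bounded_operator_restriction.
by move=> _ [|] ->; apply: restriction_commute => //; apply: comm; [left|right].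
Qed.

Lemma residual_twist_restriction U :
  twist S T U -> residual_twist (restriction K U).
Proof.
move=> [uU cU STU]; have [bU _ _] := uU.
have KU : reduces K U.
  by apply: reduces_orthocomplement => //; exact: commuting_unitary_reduces.
split; [exact: unitary_restriction | exact: commutant_restriction |].
by rewrite -restriction_comp ?STU//; apply: reduces_comp.
Qed.

(** Both [S \o T] and [T \o S] vanish on [M], the latter because it is the
    inverse of a twist composed with the former; so the block on [M] only has to
    be a unitary in the commutant. *)
Lemma twist_direct_sum U (U0 : M -> M) (V : K -> K) : twist S T U ->
  unitary U0 -> commutant [set restriction M S; restriction M T] U0 ->
  residual_twist V -> twist S T (direct_sum U0 V).
Proof.
move=> [[bU UU _] _ STU] uU0 [bU0 cU0] [uV [bV cV] STV].
have STM : restriction M (S \o T) = fun=> 0.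
  apply/funext => x; apply: val_inj.
  rewrite val_restriction ?raddf0; last exact: reduces_comp.
  by case: maxM => -[ker _ _] _; apply/ker/set_mem/valP.
have TSM : restriction M (T \o S) = fun=> 0.
  apply/funext => x; apply: val_inj.
  rewrite val_restriction ?raddf0; last exact: reduces_comp.
  have -> : (T \o S) (\val x) = adjoint U ((S \o T) (\val x)).
    by rewrite STU -[LHS]/(idfun ((T \o S) (\val x))) -UU.
  case: maxM => -[ker _ _] _; rewrite (ker (\val x) (set_mem (valP x))).
  exact/bounded_operator0/bounded_operator_adjoint.
split; first exact: unitary_direct_sum.
  split; first exact: bounded_operator_direct_sum.
  have bcomm B : bounded_operator B -> reduces M B ->
      U0 \o restriction M B = restriction M B \o U0 ->
      V \o restriction K B = restriction K B \o V ->
      direct_sum U0 V \o B = B \o direct_sum U0 V.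
    move=> bB MB comm0 comm1; rewrite -(direct_sum_restriction bB MB).
    by rewrite !direct_sum_comp comm0 comm1.
  by move=> _ [|] ->; apply: bcomm => //;
    [apply: cU0; left|apply: cV; left|apply: cU0; right|apply: cV; right].
have bST := bounded_operator_comp bS bT.
have bTS := bounded_operator_comp bT bS.
rewrite -(direct_sum_restriction bST (reduces_comp bS bT MS MT)).
rewrite -(direct_sum_restriction bTS (reduces_comp bT bS MT MS)).
rewrite direct_sum_comp STM TSM -STV; congr (direct_sum _ _).
by apply/funext => x /=; rewrite (bounded_operator0 bU0).
Qed.

(** The difference of two twists maps [K] into [K], as both reduce [M], and into
    [M]; these meet in 0. *)
Lemma restriction_twist_unique U V :
  twist S T U -> twist S T V -> restriction K U = restriction K V.
Proof.
move=> tU tV.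
have Kred U' : twist S T U' -> reduces K U'.
  move=> [uU' cU' _]; apply: reduces_orthocomplement; first by case: uU'.
  exact: commuting_unitary_reduces.
have [KU KV] := (Kred U tU, Kred V tV).
apply/funext => x; apply: val_inj; rewrite !val_restriction//.
apply/eqP; rewrite -subr_eq0 -normr_eq0 -sqrf_eq0 -inner_norm; apply/eqP.
have := twist_sub_in_core (\val x) tU tV; rewrite -(maximal_reducingE maxM).
suff : subspace_set K (U (\val x) - V (\val x)) by apply.
have Kx := set_mem (valP x).
exact: subspaceB (proj1 KU _ Kx) (proj1 KV _ Kx).
Qed.

Lemma restriction_direct_sum (U0 : M -> M) (V : K -> K) :
  U0 0 = 0 -> reduces K (direct_sum U0 V) ->
  restriction K (direct_sum U0 V) = V.
Proof.
move=> U00 KUV; apply/funext => x; apply: val_inj; rewrite val_restriction//.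
by have := direct_sumE U0 V 0 x; rewrite U00 raddf0 !add0r.
Qed.

(** Extending [V] by the identity gives a twist of [S] and [T] on [H], to which
    the comparison of twists applies. *)
Lemma residual_twist_unique U V :
  twist S T U -> residual_twist V -> V = restriction K U.
Proof.
move=> tU rV.
have tV : twist S T (direct_sum (idfun : M -> M) V).
  apply: (twist_direct_sum tU _ _ rV); first exact: unitary_idfun.
  by split; first exact: bounded_operator_id.
rewrite -(restriction_twist_unique tV tU) restriction_direct_sum//.
have [uW cW _] := tV; apply: reduces_orthocomplement; first by case: uW.
exact: commuting_unitary_reduces.
Qed.

End Decomposition.
End Twists.

Theorem proposition3p1 (R : realType) (H : hilbertType R) (S T : H -> H)
    (hST : twisted_commuting S T) :
  (exists H0 : closed_subspace H, maximal_reducing_in_kernel S T H0) /\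
  forall H0 : closed_subspace H, maximal_reducing_in_kernel S T H0 ->
    let K := orthocomplement H0 in
    let is_U1 (V : K -> K) :=
      [/\ unitary V,
          commutant [set restriction K S; restriction K T] V
        & restriction K (S \o T) = V \o restriction K (T \o S)] in
    (forall U, twist S T U -> reduces H0 U) /\
    exists U1 : K -> K,
      [/\ is_U1 U1,
          forall V, is_U1 V -> V = U1
        & twist S T =
          [set direct_sum U0 U1 | U0 in
             [set U0 : H0 -> H0 | unitary U0 /\
                commutant [set restriction H0 S; restriction H0 T] U0]]].
Proof.
have [bS bT [U tU]] := hST.
split; first by exists (reducing_core bS bT); exact: maximal_reducing_core.
move=> H0 maxH0 K is_U1.
have twist_red V : twist S T V -> reduces H0 V.
  by case=> uV cV _; exact: (commuting_unitary_reduces bS bT).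
split=> //; exists (restriction K U); split.
- exact: residual_twist_restriction.
- by move=> V; exact: residual_twist_unique.
apply/seteqP; split=> [V tV|_ [U0 [uU0 cU0] <-]].
  have [[bV _ _] cV _] := tV.
  exists (restriction H0 V).
    split; first by apply: unitary_restriction; [case: tV|exact: twist_red].
    case: maxH0 => -[_ HS HT] _.
    by apply: commutant_restriction => //; exact: twist_red.
  rewrite (restriction_twist_unique bS bT maxH0 tU tV).
  by apply: direct_sum_restriction => //; exact: twist_red.
apply: (twist_direct_sum bS bT maxH0 tU) => //.
exact: residual_twist_restriction.
Qed.
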